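(* Let $ABC$ be an (ordinary, nondegenerate) triangle in the extended Euclidean plane, and let $P$ be a point of the extended plane not lying on the extended sides of $ABC$ or of its anticomplementary triangle $K^{-1}(ABC)$. Let $P'$ be the isotomic conjugate of $P$ with respect to $ABC$, let $Q=K(P')$ and $Q'=K(P)$ be the isotomcomplements of $P$ and $P'$, respectively, let $D_0,E_0,F_0$ be the midpoints of $BC,CA,AB$, let $DEF$ and $D_3E_3F_3$ be the cevian triangles of $P$ and $P'$ with respect to $ABC$, and let $A_0$ and $A_0'$ be the midpoints of the segments $EF$ and $E_3F_3$, respectively. Then the complete quadrilaterals $$\Lambda=(AP)(AQ)(D_0Q)(D_0A_0)\quad\text{and}\quad \Lambda'=(D_0Q')(D_0A_0')(AP')(AQ')$$ are perspective by a Euclidean half-turn about the point $N_1$, where $N_1$ is the midpoint of $AD_0$, which is also the midpoint of $E_0F_0$. In particular, corresponding sides in these quadrilaterals (in the order listed) are parallel.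
   Context: The extended Euclidean plane is the Euclidean plane together with its line at infinity; a point is called ordinary if it is not on the line at infinity, and infinite otherwise. $P$ and $P'$ may be ordinary or infinite. Affine maps are extended to the line at infinity in the usual way. $K$ is the complement map of $ABC$: the homothety with center the centroid of $ABC$ and ratio $-1/2$, so that $K(A)=D_0$, $K(B)=E_0$, $K(C)=F_0$. The anticomplementary triangle of $ABC$ is $K^{-1}(ABC)$. The cevian triangle $DEF$ of $P$ has vertices $D=AP\cdot BC$, $E=BP\cdot CA$, $F=CP\cdot AB$, where a dot denotes intersection of lines. Under the hypotheses on $P$ these are ordinary points different from the vertices $A,B,C$. The isotomic conjugate $P'$ of $P$ is the common point of the lines $AD_3,BE_3,CF_3$, where $D_3,E_3,F_3$ are the reflections of $D,E,F$ in $D_0,E_0,F_0$, respectively; thus $D_3E_3F_3$ is the cevian triangle of $P'$. Equivalently, if $T_P$ and $T_{P'}$ denote the affine maps taking $ABC$ to $DEF$ and to $D_3E_3F_3$ (vertices in order), then $A_0=T_P(D_0)$ and $A_0'=T_{P'}(D_0)$. A complete quadrilateral $(l_1)(l_2)(l_3)(l_4)$ is the figure formed by the four lines $l_i$ (its sides) and their pairwise intersections (its vertices). That $\Lambda$ and $\Lambda'$ are perspective by the half-turn about $N_1$ means that the rotation by $180^\circ$ about $N_1$ maps the sides of $\Lambda$ onto the sides of $\Lambda'$ in the order listed, i.e. $AP\mapsto D_0Q'$, $AQ\mapsto D_0A_0'$, $D_0Q\mapsto AP'$, $D_0A_0\mapsto AQ'$ (and hence corresponding vertices to corresponding vertices).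 Coincident lines are regarded as parallel. *)

(* Defs.v *)
From mathcomp Require Import all_boot all_order all_algebra.
From mathcomp Require Import boolp classical_sets reals.

Set Implicit Arguments.
Unset Strict Implicit.
Unset Printing Implicit Defensive.

Import Order.TTheory GRing.Theory Num.Theory.

Local Open Scope ring_scope.
Local Open Scope classical_set_scope.

(* The extended Euclidean plane: R^2 together with one infinite point for each
   one-dimensional direction of R^2.  Leibniz equality is the intended equality
   of points, and lines (sets of points) are compared as sets. *)
Definition direction (R : realType) : Type :=
  {U : {vspace 'rV[R]_2} | \dim U == 1%N}.

Inductive ext_point (R : realType) : Type :=
| Ordinary of 'rV[R]_2
| Infinite of direction R.

Section ExtendedPlane.
Variable R : realType.
Implicit Types (a b c : 'rV[R]_2) (U V : {vspace 'rV[R]_2}).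
Implicit Types (X Y : ext_point R) (l m : set (ext_point R)).

(* A line of the Euclidean plane with its infinite point adjoined; this is an
   actual line exactly when \dim U = 1. *)
Definition affine_line a U : set (ext_point R) :=
  [set Z | match Z with
           | Ordinary c => c - a \in U
           | Infinite V => val V = U
           end].

Definition line_at_infinity : set (ext_point R) :=
  [set Z | if Z is Infinite _ then True else False].

(* The line joining X and Y, for X <> Y.  For X = Y = Ordinary a the value is
   the singleton of X, which is not a line in the sense of is_line. *)
Definition line X Y : set (ext_point R) :=
  match X, Y with
  | Ordinary a, Ordinary b => affine_line a <[b - a]>%VS
  | Ordinary a, Infinite U => affine_line a (val U)
  | Infinite U, Ordinary a => affine_line a (val U)
  | Infinite _, Infinite _ => line_at_infinity
  end.

Definition is_line l : Prop := exists X Y, X <> Y /\ l = line X Y.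

Definition collinear a b c : Prop :=
  exists l, is_line l /\ [/\ l (Ordinary a), l (Ordinary b) & l (Ordinary c)].

(* Parallelism of ordinary lines; a line is parallel to itself. *)
Definition parallel l m : Prop :=
  exists a b (U : direction R),
    l = affine_line a (val U) /\ m = affine_line b (val U).

Definition midpoint a b : 'rV[R]_2 := 2^-1 *: (a + b).

Definition centroid a b c : 'rV[R]_2 := 3^-1 *: (a + b + c).

Definition homothety (o : 'rV[R]_2) (k : R) a : 'rV[R]_2 := o + k *: (a - o).

(* Extension of a homothety of ratio k != 0 to the line at infinity: its linear
   part is scalar, so it fixes every direction. *)
Definition ext_homothety (o : 'rV[R]_2) (k : R) X : ext_point R :=
  match X with
  | Ordinary a => Ordinary (homothety o k a)
  | Infinite U => Infinite U
  end.

(* The half-turn about o is also the reflection in the point o. *)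
Definition half_turn o : 'rV[R]_2 -> 'rV[R]_2 := homothety o (- 1).
Definition ext_half_turn o : ext_point R -> ext_point R :=
  ext_homothety o (- 1).

Definition complement_map a b c : ext_point R -> ext_point R :=
  ext_homothety (centroid a b c) (- 2^-1).

Definition anticomplement a b c : 'rV[R]_2 -> 'rV[R]_2 :=
  homothety (centroid a b c) (- 2^-1)^-1.

Definition on_sides a b c X : Prop :=
  [\/ line (Ordinary b) (Ordinary c) X,
      line (Ordinary c) (Ordinary a) X |
      line (Ordinary a) (Ordinary b) X].

(* (d, e, f) is the cevian triangle of X with respect to (a, b, c). *)
Definition cevian_triangle a b c X d e f : Prop :=
  [/\ (line (Ordinary a) X `&` line (Ordinary b) (Ordinary c)) (Ordinary d),
      (line (Ordinary b) X `&` line (Ordinary c) (Ordinary a)) (Ordinary e) &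
      (line (Ordinary c) X `&` line (Ordinary a) (Ordinary b)) (Ordinary f)].

(* A quadrilateral is given by its four sides in order; sides may coincide. *)
Definition quadrilateral : Type := 'I_4 -> set (ext_point R).

Definition quad (l1 l2 l3 l4 : set (ext_point R)) : quadrilateral :=
  tnth [tuple l1; l2; l3; l4].

Implicit Types L : quadrilateral.

Definition complete_quadrilateral L : Prop := forall i, is_line (L i).

(* At most one point; empty when the sides i and j coincide. *)
Definition vertex L (i j : 'I_4) : set (ext_point R) :=
  [set X | L i <> L j /\ (L i `&` L j) X].

Definition perspective_by (h : ext_point R -> ext_point R) L L' : Prop :=
  (forall i, h @` L i = L' i) /\
  (forall i j, h @` vertex L i j = vertex L' i j).

End ExtendedPlane.

(* Main.v *)
(* In barycentric coordinates, P = (x : y : z) and P' = (yz : zx : xy).  Up to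
   scaling the four lines of each quadrilateral, taken in order, have the same
   directions with respect to the basis B - A, C - A: (y, z),
   (y(x+z), z(x+y)), (xz, xy) and (x+z, x+y).  In each pair one line passes
   through A and the other through D0, so the half-turn about the midpoint of
   A D0 exchanges them.  Homogeneous coordinates treat ordinary and infinite
   P, P' uniformly. *)
Require Import Defs.
From mathcomp Require Import all_boot all_order all_algebra.
From mathcomp Require Import boolp classical_sets reals.
From mathcomp Require Import ring lra.

Set Implicit Arguments.
Unset Strict Implicit.
Unset Printing Implicit Defensive.

Import Order.TTheory GRing.Theory Num.Theory.

Local Open Scope ring_scope.
Local Open Scope classical_set_scope.

(** * Homogeneous coordinates on the extended plane *)

Section Homogeneous.
Variable R : realType.
Implicit Types (a b c o u v : 'rV[R]_2) (X : ext_point R).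

(* The pair (w, v) stands for a triple of homogeneous coordinates; w = 0 is the
   line at infinity, and v <> 0 there because a direction has dimension 1. *)
Definition homogeneous X (w : R) v : Prop :=
  match X with
  | Ordinary a => w != 0 /\ v = w *: a
  | Infinite U => w = 0 /\ val U = <[v]>%VS
  end.

Lemma homogeneous_exists X : exists w v, homogeneous X w v.
Proof.
case: X => [a|[U dimU]]; first by exists 1, a; rewrite /= oner_neq0 scale1r.
exists 0, (vpick U); split=> //=; apply/esym/eqP.
rewrite eqEdim -memvE memv_pick dim_vline vpick0 (eqP dimU) /=.
by rewrite -dimv_eq0 (eqP dimU).
Qed.

Lemma infinite_neq0 (U : direction R) v : val U = <[v]>%VS -> v != 0.
Proof.
case: U => U dimU /= eqU; apply/eqP => v0.
by move: dimU; rewrite eqU v0 dim_vline eqxx.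
Qed.

Lemma homogeneous_neq0 X v : homogeneous X 0 v -> v != 0.
Proof. by case: X => [a|U] [] => [|_ /infinite_neq0 //]; rewrite eqxx. Qed.

Lemma vline_scale (k : R) u : k != 0 -> <[k *: u]>%VS = <[u]>%VS.
Proof.
move=> k0; apply: subv_anti; rewrite -!memvE memvZ ?memv_line //=.
by rewrite -[X in X \in _](scalerK k0) memvZ ?memv_line.
Qed.

Lemma memv_scale (k : R) (U : {vspace 'rV[R]_2}) v :
  k != 0 -> (k *: v \in U) = (v \in U).
Proof. by move=> k0; rewrite rpredZeq (negPf k0). Qed.

Lemma homogeneous_scale X w v k :
  k != 0 -> homogeneous X w v -> homogeneous X (k * w) (k *: v).
Proof.
move=> k0; case: X => [a|U] /= [w0 ->]; split; rewrite ?mulf_neq0 ?scalerA //.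
  by rewrite w0 mulr0.
by rewrite vline_scale.
Qed.

Lemma line_homogeneous a X w v : homogeneous X w v ->
  line (Ordinary a) X = affine_line a <[v - w *: a]>%VS.
Proof.
case: X => [b|U] /= [w0 ->]; first by rewrite -scalerBr vline_scale.
by rewrite w0 scale0r subr0.
Qed.

(** Makes incidence one linear condition for ordinary and infinite points alike. At infinity [w = 0]
    and [v != 0], so [v \in <[u]>] already forces equality of the two spans by dimension. *)
Lemma affine_line_homogeneous a u X w v : homogeneous X w v ->
  affine_line a <[u]>%VS X <-> v - w *: a \in <[u]>%VS.
Proof.
case: X => [b|U] /= [w0 eqv]; first by rewrite eqv -scalerBr memv_scale.
have v0 := infinite_neq0 eqv.
rewrite eqv w0 scale0r subr0; split=> [<-|]; first exact: memv_line.
move=> vu; apply/eqP; rewrite eqEdim -memvE vu !dim_vline v0.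
by case: (u != 0).
Qed.

Lemma homogeneous_homothety o k X w v : k != 0 -> homogeneous X w v ->
  homogeneous (ext_homothety o k X) w (w *: o + k *: (v - w *: o)).
Proof.
move=> k0; case: X => [b|U] /= [w0 eqv]; split=> //.
  by rewrite eqv /homothety -scalerBr [RHS]scalerDr !scalerA mulrC.
by rewrite w0 scale0r add0r subr0 vline_scale.
Qed.

End Homogeneous.

(** * Lines, half-turns and perspective quadrilaterals *)

Section Lines.
Variable R : realType.
Implicit Types (a b c o u v : 'rV[R]_2) (X : ext_point R).

Lemma is_line_affine_line a u : u != 0 -> is_line (affine_line a <[u]>%VS).
Proof.
move=> u0; exists (Ordinary a), (Ordinary (a + u)); split.
  by case=> /esym/eqP; rewrite -subr_eq0 addrAC subrr add0r (negPf u0).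
by rewrite /= addrAC subrr add0r.
Qed.

Lemma parallel_affine_line a b u : u != 0 ->
  parallel (affine_line a <[u]>%VS) (affine_line b <[u]>%VS).
Proof.
move=> u0; have dimu : \dim <[u]>%VS == 1%N by rewrite dim_vline u0.
by exists a, b, (exist _ <[u]>%VS dimu).
Qed.

Lemma half_turnE o a : half_turn o a = o + o - a.
Proof. by apply/rowP => i; rewrite !mxE; ring. Qed.

Lemma ext_half_turnK o : involutive (ext_half_turn o).
Proof.
case=> [a|//]; congr Ordinary; rewrite -!/(half_turn _ _) !half_turnE.
by rewrite opprB addrCA subrr addr0.
Qed.

(** The half-turn sends [c] to [a + b - c], whose displacement from [b] is [- (c - a)]; infinite
    points are fixed. *)
Lemma half_turn_affine_line a b (U : {vspace 'rV[R]_2}) X :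
  affine_line a U X -> affine_line b U (ext_half_turn (midpoint a b) X).
Proof.
case: X => [c|//] /= cU; rewrite -/(half_turn _ _) half_turnE.
have -> : midpoint a b + midpoint a b - c - b = - (c - a).
  by apply/rowP => i; rewrite !mxE; field.
by rewrite memvN.
Qed.

Lemma midpointC a b : midpoint a b = midpoint b a.
Proof. by rewrite /midpoint addrC. Qed.

Lemma image_half_turn_affine_line a b (U : {vspace 'rV[R]_2}) :
  ext_half_turn (midpoint a b) @` affine_line a U = affine_line b U.
Proof.
apply/seteqP; split=> [_ [X aX <-]|X bX]; first exact: half_turn_affine_line.
exists (ext_half_turn (midpoint a b) X); last exact: ext_half_turnK.
by rewrite midpointC; exact: half_turn_affine_line.
Qed.

(** An involution is a bijection, so it commutes with intersections and keeps distinct sides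
    distinct; the vertices therefore follow the sides. *)
Lemma perspective_by_sides (h : ext_point R -> ext_point R)
    (L L' : quadrilateral R) :
  involutive h -> (forall i, h @` L i = L' i) -> perspective_by h L L'.
Proof.
move=> hK hL; split=> // i j.
have himage (l : set (ext_point R)) : h @` (h @` l) = l.
  apply/seteqP; split=> [_ [_ [X lX <-] <-]|X lX]; first by rewrite hK.
  by exists (h X); rewrite ?hK //; exists X.
have hmem k X : L' k (h X) <-> L k X.
  rewrite -hL; split=> [[Y LY /(inv_inj hK) <-] //|LX]; by exists X.
apply/seteqP; split=> [_ [X [neq [Xi Xj]] <-]|X [neq [Xi Xj]]].
  split; last by split; apply/hmem.
  by move=> eqL; apply: neq; rewrite -[L i]himage -[L j]himage !hL eqL.
exists (h X); last exact: hK.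
split; first by move=> eqL; apply: neq; rewrite -!hL eqL.
by split; apply/hmem; rewrite hK.
Qed.

End Lines.

(** * Barycentric coordinates, cevian traces, isotomic conjugates and complements *)

Section Barycentric.
Variable R : realType.
Implicit Types (a b c d u v : 'rV[R]_2) (X : ext_point R).

Lemma collinear_vline a b c u : u != 0 ->
  b - a \in <[u]>%VS -> c - a \in <[u]>%VS -> collinear a b c.
Proof.
move=> u0 bu cu; exists (affine_line a <[u]>%VS).
split; first exact: is_line_affine_line.
by split=> //=; rewrite subrr mem0v.
Qed.

Lemma collinear_rot a b c : collinear b c a -> collinear a b c.
Proof. by case=> l [ll [lb lc la]]; exists l. Qed.

Lemma noncollinear_free a b c :
  ~ collinear a b c -> free [:: b - a; c - a].
Proof.
move=> ncol; rewrite free_cons span_seq1 seq1_free.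
case: (eqVneq (c - a) 0) => [ca0|ca0].
  case: (eqVneq (b - a) 0) => [ba0|ba0]; exfalso; apply: ncol.
    (* All three points coincide, so any nonzero direction serves. *)
    apply: (@collinear_vline _ _ _ (const_mx 1)).
    - by apply/eqP => /rowP/(_ 0); rewrite !mxE; apply/eqP/oner_neq0.
    - by rewrite ba0 mem0v.
    - by rewrite ca0 mem0v.
  by apply: (collinear_vline ba0); rewrite ?memv_line // ca0 mem0v.
rewrite andbT; apply/negP => bac; apply: ncol.
by apply: (collinear_vline ca0) => //; exact: memv_line.
Qed.

(** Affine independence of the vertices; it is what permits comparing coefficients below. *)
Lemma barycentric_indep a b c : ~ collinear a b c -> forall x y z : R,
  x + y + z = 0 -> x *: a + y *: b + z *: c = 0 -> [/\ x = 0, y = 0 & z = 0].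
Proof.
move=> /noncollinear_free; rewrite free_cons span_seq1 seq1_free.
case/andP=> bac ca0 x y z xyz eq0.
have eq1 : y *: (b - a) + z *: (c - a) = 0.
  rewrite -eq0 (_ : x = - y - z); last by lra.
  by apply/rowP => i; rewrite !mxE; ring.
have y0 : y = 0.
  apply/eqP; apply: contraNT bac => y0.
  rewrite -(memv_scale _ _ y0).
  move/eqP: eq1; rewrite addr_eq0 => /eqP ->.
  by rewrite memvN memvZ ?memv_line.
have z0 : z = 0.
  move/eqP: eq1; rewrite y0 scale0r add0r scaler_eq0 (negPf ca0) orbF.
  by move/eqP.
by split=> //; lra.
Qed.

(** Coordinates are not normalized: their sum is the weight, which vanishes exactly when [X] is
    infinite. *)
Definition barycentric a b c X (x y z : R) : Prop :=
  homogeneous X (x + y + z) (x *: a + y *: b + z *: c).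

(** Lets the statements about the vertex [a] be reused at [b] and [c]. *)
Lemma barycentric_rot a b c X x y z :
  barycentric a b c X x y z -> barycentric b c a X y z x.
Proof.
rewrite /barycentric (_ : y + z + x = x + y + z); last by ring.
rewrite (_ : y *: b + z *: c + x *: a = x *: a + y *: b + z *: c) //.
by rewrite -addrA addrC -addrA addrC addrAC addrC addrA addrC addrA.
Qed.

Lemma barycentric_exists a b c X : ~ collinear a b c ->
  exists x y z, barycentric a b c X x y z.
Proof.
move=> /noncollinear_free fr.
have [w [v hX]] := homogeneous_exists X.
have : v - w *: a \in <<[:: b - a; c - a]>>%VS.
  suff -> : <<[:: b - a; c - a]>>%VS = fullv by rewrite memvf.
  apply/eqP; rewrite eqEdim subvf (eqP fr) dimvf /=.
  by rewrite /dim /= mul1n.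
rewrite span_cons span_seq1 => /memv_addP[_ /vlineP[y ->] [_ /vlineP[z ->]]].
move=> eqv; exists (w - y - z), y, z; rewrite /barycentric.
rewrite (_ : _ + _ = w); last by ring.
rewrite (_ : _ + _ = v) //.
rewrite -[v](subrK (w *: a)) eqv.
by apply/rowP => i; rewrite !mxE; ring.
Qed.

Lemma line_barycentric a b c X x y z : barycentric a b c X x y z ->
  line (Ordinary a) X = affine_line a <[y *: (b - a) + z *: (c - a)]>%VS.
Proof.
move=> /line_homogeneous ->; congr (affine_line a <[_]>%VS).
by apply/rowP => i; rewrite !mxE; ring.
Qed.

Lemma barycentric_side a b c X y z : barycentric a b c X 0 y z ->
  line (Ordinary b) (Ordinary c) X.
Proof.
move=> /(affine_line_homogeneous b (c - b)) hX; apply/hX/vlineP.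
by exists z; apply/rowP => i; rewrite !mxE; ring.
Qed.

Lemma barycentric_off_sides a b c X x y z : barycentric a b c X x y z ->
  ~ on_sides a b c X -> [/\ x != 0, y != 0 & z != 0].
Proof.
move=> hX off; split; apply/eqP => eq0; apply: off; move: hX; rewrite eq0.
- by move=> /barycentric_side; constructor 1.
- by move=> /barycentric_rot/barycentric_side; constructor 2.
- by move=> /barycentric_rot/barycentric_rot/barycentric_side; constructor 3.
Qed.

Lemma barycentric_trace a b c d X x y z :
  ~ collinear a b c -> barycentric a b c X x y z ->
  (line (Ordinary a) X `&` line (Ordinary b) (Ordinary c)) (Ordinary d) ->
  y + z != 0 /\ d = (y + z)^-1 *: (y *: b + z *: c).
Proof.
move=> /barycentric_indep indep /line_barycentric -> [/= /vlineP[s das]].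
move=> /vlineP[t dbt].
(* Coefficients of the difference of the two expressions for [d], as a point of the cevian and as a
   point of the side. The first one gives [s * (y + z) = 1], hence [y + z != 0]. *)
have [] := indep (1 - s * y - s * z) (s * y - 1 + t) (s * z - t).
- by ring.
- rewrite (_ : _ + _ =
      s *: (y *: (b - a) + z *: (c - a)) - t *: (c - b) + a - b).
    by rewrite -das -dbt; apply/rowP => i; rewrite !mxE; ring.
  by apply/rowP => i; rewrite !mxE; ring.
move=> syz _ _.
have yz0 : y + z != 0 by apply/eqP => yz0; have := mulr0 s; rewrite -yz0; lra.
split=> //; rewrite -[d](subrK a) das.
have -> : s = (y + z)^-1 by apply: (mulIf yz0); rewrite mulVf //; lra.
by apply/rowP => i; rewrite !mxE; field.
Qed.

(** Reflecting the trace in the midpoint swaps its weights, giving [z *: b + y *: c] up to scale; a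
    point on the new cevian has [y'] and [z'] proportional to [z] and [y]. *)
Lemma barycentric_isotomic a b c d X x' y' z' (y z : R) :
  ~ collinear a b c -> y + z != 0 -> d = (y + z)^-1 *: (y *: b + z *: c) ->
  barycentric a b c X x' y' z' ->
  line (Ordinary a) (Ordinary (half_turn (midpoint b c) d)) X ->
  y * y' = z * z'.
Proof.
move=> /barycentric_indep indep yz0 -> hX.
move=> /(affine_line_homogeneous _ _ hX)/vlineP[k eqk].
(* Coefficients of the incidence equation after clearing the denominator [y + z]. *)
have [] := indep (k * (y + z) - (y + z) * (y' + z'))
                 ((y + z) * y' - k * z) ((y + z) * z' - k * y).
- by ring.
- move/eqP: eqk; rewrite -subr_eq0 half_turnE => /eqP eqk.
  rewrite -[RHS](scaler0 _ (y + z)) -eqk.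
  by apply/rowP => i; rewrite !mxE; field.
move=> _ ey ez; apply: (mulfI yz0).
rewrite (_ : _ * (y * y') = y * ((y + z) * y')); last by ring.
rewrite (_ : _ * (z * z') = z * ((y + z) * z')); last by ring.
by rewrite (subr0_eq ey) (subr0_eq ez); ring.
Qed.

Lemma barycentric_scale a b c X x y z k : k != 0 ->
  barycentric a b c X x y z -> barycentric a b c X (k * x) (k * y) (k * z).
Proof.
move=> k0 /(homogeneous_scale k0); rewrite /barycentric.
by rewrite !mulrDr !scalerDr !scalerA.
Qed.

Lemma barycentric_complement a b c X x y z : barycentric a b c X x y z ->
  barycentric a b c (complement_map a b c X) (y + z) (z + x) (x + y).
Proof.
have k0 : - 2^-1 != 0 :> R by rewrite oppr_eq0 invr_neq0 ?pnatr_eq0.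
have two0 : 2 != 0 :> R by rewrite pnatr_eq0.
move=> /(homogeneous_homothety (centroid a b c) k0)/(homogeneous_scale two0).
rewrite /barycentric (_ : 2 * _ = y + z + (z + x) + (x + y)); last by ring.
rewrite (_ : 2 *: _ = (y + z) *: a + (z + x) *: b + (x + y) *: c) //.
by apply/rowP => i; rewrite !mxE; field.
Qed.

(** The complement map takes [a] to the midpoint of [b] and [c] and preserves directions, so the
    image of the line from [a] to [X] is parallel to it. *)
Lemma line_midpoint_complement a b c X x y z : barycentric a b c X x y z ->
  line (Ordinary (midpoint b c)) (complement_map a b c X)
  = affine_line (midpoint b c) <[y *: (b - a) + z *: (c - a)]>%VS.
Proof.
move=> /barycentric_complement/line_homogeneous ->.
have m0 : - 1 != 0 :> R by rewrite oppr_eq0 oner_neq0.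
congr (affine_line _ _); rewrite -[RHS](vline_scale _ m0); congr (<[_]>%VS).
by apply/rowP => i; rewrite !mxE; field.
Qed.

(** The products [x * x'], [y * y'], [z * z'] agree, so the primed triple is proportional to the
    reciprocals of [x], [y], [z], that is, to [(y * z, z * x, x * y)]. *)
Lemma barycentric_isotomic_conjugate a b c X x y z x' y' z' :
  [/\ x != 0, y != 0 & z != 0] ->
  y * y' = z * z' -> z * z' = x * x' ->
  barycentric a b c X x' y' z' -> barycentric a b c X (y * z) (z * x) (x * y).
Proof.
move=> [x0 y0 z0] eyz ezx hX.
have x'E : x' = x * x' / (x * y * z) * (y * z) by field; rewrite ?x0 ?y0 ?z0.
have y'E : y' = x * x' / (x * y * z) * (z * x).
  by rewrite -ezx -eyz; field; rewrite ?x0 ?y0 ?z0.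
have z'E : z' = x * x' / (x * y * z) * (x * y).
  by rewrite -ezx; field; rewrite ?x0 ?y0 ?z0.
move: hX; rewrite x'E y'E z'E; set k := _ / _ => hX.
(* A zero factor would make all three coordinates vanish, which represents no point. *)
have k0 : k != 0.
  apply/eqP => k0; move: hX; rewrite k0 !mul0r /barycentric !addr0.
  by move=> /homogeneous_neq0; rewrite !scale0r !addr0 eqxx.
have k1 : k^-1 != 0 by rewrite invr_neq0.
by have := barycentric_scale k1 hX; rewrite !mulKf.
Qed.

(** Here [y] and [z] are affine parameters along the sides from [a]. Subtracting midpoints gives a
    direction with coefficients [(y - 1) / 2] and [(z - 1) / 2]; [k] is the factor to a
    denominator-free form. *)
Lemma line_midpoint_midpoint a b c (y z y' z' k : R) : k != 0 ->
  2^-1 * (y - 1) = k * y' -> 2^-1 * (z - 1) = k * z' ->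
  line (Ordinary (midpoint b c))
       (Ordinary (midpoint (a + z *: (c - a)) (a + y *: (b - a))))
  = affine_line (midpoint b c) <[y' *: (b - a) + z' *: (c - a)]>%VS.
Proof.
move=> k0 ey ez; rewrite /line; congr (affine_line _ _).
rewrite -[RHS](vline_scale _ k0); congr (<[_]>%VS).
rewrite [RHS]scalerDr !scalerA -ey -ez.
by apply/rowP => i; rewrite !mxE; field.
Qed.

End Barycentric.

(** * The two quadrilaterals and their half-turn *)

Theorem theorem1p1 (R : realType)
  (A B C D0 E0 F0 D E F D3 E3 F3 A0 A0' N1 : 'rV[R]_2)
  (P P' Q Q' : ext_point R)
  (hABC : ~ collinear A B C)
  (hP : ~ on_sides A B C P)
  (hPanti : ~ on_sides (anticomplement A B C A) (anticomplement A B C B)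
                       (anticomplement A B C C) P)
  (hD0 : D0 = midpoint B C)
  (hE0 : E0 = midpoint C A)
  (hF0 : F0 = midpoint A B)
  (hDEF : cevian_triangle A B C P D E F)
  (hD3 : D3 = half_turn D0 D)
  (hE3 : E3 = half_turn E0 E)
  (hF3 : F3 = half_turn F0 F)
  (hP' : [/\ line (Ordinary A) (Ordinary D3) P',
             line (Ordinary B) (Ordinary E3) P' &
             line (Ordinary C) (Ordinary F3) P'])
  (hQ : Q = complement_map A B C P')
  (hQ' : Q' = complement_map A B C P)
  (hA0 : A0 = midpoint E F)
  (hA0' : A0' = midpoint E3 F3)
  (hN1 : N1 = midpoint A D0) :
  let Lambda := quad (line (Ordinary A) P) (line (Ordinary A) Q)
                     (line (Ordinary D0) Q)
                     (line (Ordinary D0) (Ordinary A0)) in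
  let Lambda' := quad (line (Ordinary D0) Q')
                      (line (Ordinary D0) (Ordinary A0'))
                      (line (Ordinary A) P') (line (Ordinary A) Q') in
  [/\ complete_quadrilateral Lambda,
      complete_quadrilateral Lambda',
      N1 = midpoint E0 F0,
      perspective_by (ext_half_turn N1) Lambda Lambda' &
      forall i : 'I_4, parallel (Lambda i) (Lambda' i)].
Proof.
have hBCA : ~ collinear B C A by move=> /collinear_rot.
have hCAB : ~ collinear C A B by move=> /collinear_rot.
have [x [y [z bP]]] := barycentric_exists P hABC.
have nz := barycentric_off_sides bP hP.
have [x0 y0 z0] := nz.
have bP1 := barycentric_rot bP; have bP2 := barycentric_rot bP1.
case: hDEF => tD tE tF.
have [yz0 DE] := barycentric_trace hABC bP tD.
have [zx0 EE] := barycentric_trace hBCA bP1 tE.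
have [xy0 FE] := barycentric_trace hCAB bP2 tF.
have [x' [y' [z' bP']]] := barycentric_exists P' hABC.
have bP'1 := barycentric_rot bP'; have bP'2 := barycentric_rot bP'1.
rewrite hD3 hE3 hD0 hE0 in hP'; case: hP' => tD3 tE3 _.
have {bP' bP'1 bP'2 tD3 tE3} bP' : barycentric A B C P' (y * z) (z * x) (x * y).
  apply: (barycentric_isotomic_conjugate nz _ _ bP').
    exact: (barycentric_isotomic hABC yz0 DE bP' tD3).
  exact: (barycentric_isotomic hBCA zx0 EE bP'1 tE3).
have bQ := barycentric_complement bP'; have bQ' := barycentric_complement bP.
have indep := barycentric_indep hABC.
have dir_neq0 s t : s != 0 -> s *: (B - A) + t *: (C - A) != 0.
  move=> s0; apply/eqP => eq0; have [] := indep (- s - t) s t.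
  - by ring.
  - by rewrite -eq0; apply/rowP => i; rewrite !mxE; ring.
  by move=> _ /eqP; rewrite (negPf s0).
have E_A : E = A + (z / (z + x)) *: (C - A).
  by rewrite EE; apply/rowP => i; rewrite !mxE; field.
have F_A : F = A + (y / (x + y)) *: (B - A).
  by rewrite FE; apply/rowP => i; rewrite !mxE; field.
have E3_A : E3 = A + (x / (z + x)) *: (C - A).
  by rewrite hE3 hE0 half_turnE E_A; apply/rowP => i; rewrite !mxE; field.
have F3_A : F3 = A + (x / (x + y)) *: (B - A).
  by rewrite hF3 hF0 half_turnE F_A; apply/rowP => i; rewrite !mxE; field.
(* The directions of the lines from [A] to [P], [Q], [P'], [Q'], read off their second and third
   barycentric coordinates. *)
pose u1 := y *: (B - A) + z *: (C - A).
pose u2 := (x * y + y * z) *: (B - A) + (y * z + z * x) *: (C - A).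
pose u3 := (z * x) *: (B - A) + (x * y) *: (C - A).
pose u4 := (z + x) *: (B - A) + (x + y) *: (C - A).
have u1_neq0 : u1 != 0 by exact: dir_neq0.
have u2_neq0 : u2 != 0.
  (* The factor [z + x] is nonzero because the trace [E] is ordinary. *)
  by apply: dir_neq0; rewrite (_ : _ + _ = y * (z + x)) ?mulf_neq0 //; ring.
have u3_neq0 : u3 != 0 by apply: dir_neq0; rewrite mulf_neq0.
have u4_neq0 : u4 != 0 by exact: dir_neq0.
have D0A0 : line (Ordinary D0) (Ordinary A0) = affine_line D0 <[u4]>%VS.
  rewrite hA0 E_A F_A hD0.
  (* The factor solves [(y / (x + y) - 1) / 2 = k * (z + x)], the left side being
     [- x / (2 * (x + y))]. *)
  apply: (@line_midpoint_midpoint _ _ _ _ _ _ _ _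
           (- (x / (2 * (x + y) * (z + x))))).
  - by rewrite oppr_eq0 !mulf_neq0 ?invr_neq0 ?mulf_neq0 ?pnatr_eq0.
  - by field; rewrite xy0 zx0.
  - by field; rewrite xy0 zx0.
have D0A0' : line (Ordinary D0) (Ordinary A0') = affine_line D0 <[u2]>%VS.
  rewrite hA0' E3_A F3_A hD0.
  apply: (@line_midpoint_midpoint _ _ _ _ _ _ _ _
           (- (2 * (x + y) * (z + x))^-1)).
  - by rewrite oppr_eq0 invr_neq0 ?mulf_neq0 ?pnatr_eq0.
  - by field; rewrite xy0 zx0.
  - by field; rewrite xy0 zx0.
(* Side [i] of each figure has direction [u i]; it passes through [p i] in [Lambda] and through
   [p' i] in [Lambda'], these being [A] and [D0] in one order or the other. *)
pose u := tnth [tuple u1; u2; u3; u4].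
pose p := tnth [tuple A; A; D0; D0].
pose p' := tnth [tuple D0; D0; A; A].
move=> Lambda Lambda'.
have u_neq0 i : u i != 0 by case: i => -[|[|[|[|]]]].
have LambdaE i : Lambda i = affine_line (p i) <[u i]>%VS.
  rewrite /Lambda D0A0 (line_barycentric bP) hQ (line_barycentric bQ).
  rewrite hD0 (line_midpoint_complement bP') -hD0.
  by case: i => -[|[|[|[|]]]].
have Lambda'E i : Lambda' i = affine_line (p' i) <[u i]>%VS.
  rewrite /Lambda' D0A0' (line_barycentric bP') hQ' (line_barycentric bQ').
  rewrite hD0 (line_midpoint_complement bP) -hD0.
  by case: i => -[|[|[|[|]]]].
split.
- by move=> i; rewrite LambdaE; exact: is_line_affine_line.
- by move=> i; rewrite Lambda'E; exact: is_line_affine_line.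
- by rewrite hN1 hD0 hE0 hF0; apply/rowP => i; rewrite !mxE; field.
- apply: perspective_by_sides; first exact: ext_half_turnK.
  move=> i; rewrite LambdaE Lambda'E.
  have -> : N1 = midpoint (p i) (p' i).
    by case: i => -[|[|[|[|]]]] //= ?; rewrite hN1 midpointC.
  exact: image_half_turn_affine_line.
- by move=> i; rewrite LambdaE Lambda'E; exact: parallel_affine_line.
Qed.
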